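(* Let $\bar{\mathcal G}$ be a (time-invariant) digraph on the node set $\{0,1,\dots,N\}$ with weighted adjacency matrix $[a_{ij}]_{i,j=0}^N$, such that every node $i=1,\dots,N$ is reachable from node $0$, and let $H\in\mathbb R^{N\times N}$ be the associated matrix defined in the context. Let $S_0\in\mathbb R^{q\times q}$ have eigenvalues $\lambda_1,\dots,\lambda_q$ with $0\le|\lambda_1|\le\cdots\le|\lambda_q|$ and $\lambda_q\ne 0$. Denote the eigenvalues of $H$ (with multiplicity) by $a_l\pm \mathrm{j}\,b_l$, $l=1,\dots,N_2$, where $\mathrm j=\sqrt{-1}$, $a_l,b_l\in\mathbb R$, $b_l=0$ for $1\le l\le N_1$ (each such $l$ contributing the single real eigenvalue $a_l$), $b_l\neq 0$ for $N_1+1\le l\le N_2$ (each such $l$ contributing a complex conjugate pair), $0\le N_1\le N$ and $N_1+2(N_2-N_1)=N$. Put $\Delta_l=\frac{a_l^2+b_l^2}{|\lambda_q|^2}-b_l^2$. Then there exists a real number $\mu$ such that the matrix $(I_N\otimes S_0)-\mu(H\otimes S_0)$ is Schur if and only if both $$a_l^2+b_l^2> b_l^2|\lambda_q|^2,\qquad l=1,\dots,N_2,$$ and $$\max_{l=1,\dots,N_2}\left\{\frac{a_l-\sqrt{\Delta_l}}{a_l^2+b_l^2}\right\}<\min_{l=1,\dots,N_2}\left\{\frac{a_l+\sqrt{\Delta_l}}{a_l^2+b_l^2}\right\}.$$ Moreover, if these two conditions are satisfied, then $(I_N\otimes S_0)-\mu(H\otimes S_0)$ is Schur for all $\mu$ satisfying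 $$\max_{l=1,\dots,N_2}\left\{\frac{a_l-\sqrt{\Delta_l}}{a_l^2+b_l^2}\right\}<\mu<\min_{l=1,\dots,N_2}\left\{\frac{a_l+\sqrt{\Delta_l}}{a_l^2+b_l^2}\right\}.$$
   Context: A digraph $\bar{\mathcal G}=(\bar{\mathcal V},\bar{\mathcal E})$ has node set $\bar{\mathcal V}=\{0,1,\dots,N\}$ and edge set $\bar{\mathcal E}\subseteq\bar{\mathcal V}\times\bar{\mathcal V}$; $(i,j)\in\bar{\mathcal E}$ denotes an edge from $i$ to $j$. Node $i_{k+1}$ is reachable from node $i_1$ if there are edges $(i_1,i_2),(i_2,i_3),\dots,(i_k,i_{k+1})$ in $\bar{\mathcal E}$. A weighted adjacency matrix is $[a_{ij}]\in\mathbb R^{(N+1)\times(N+1)}$, $i,j=0,\dots,N$, with $a_{ii}=0$, and, for $i\ne j$, $a_{ij}>0$ if $(j,i)\in\bar{\mathcal E}$ and $a_{ij}=0$ otherwise. The matrix $H=[h_{ij}]\in\mathbb R^{N\times N}$, $i,j=1,\dots,N$, is defined by $h_{ii}=\sum_{j=0}^N a_{ij}$ and $h_{ij}=-a_{ij}$ for $i\ne j$. (The entries $a_{ij}$ with two indices are adjacency weights; $a_l$ with one index is the real part of an eigenvalue of $H$.) A square matrix is Schur if all its eigenvalues have modulus smaller than $1$. $\otimes$ is the Kronecker product. *)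

(* Defs.v *)
From mathcomp Require Import all_boot all_order all_algebra.
From mathcomp Require Import reals constructive_ereal.
From mathcomp Require Export complex mxtens.

Set Implicit Arguments.
Unset Strict Implicit.
Unset Printing Implicit Defensive.

Import Order.TTheory GRing.Theory Num.Theory.
Local Open Scope ring_scope.
Local Open Scope complex_scope.

Notation cmod := ComplexField.Normc.normc.

Definition complexify (R : realType) m n (A : 'M[R]_(m, n)) : 'M[R[i]]_(m, n) :=
  map_mx (real_complex R) A.

Definition schur_stable (R : realType) n (A : 'M[R]_n) : Prop :=
  forall z : R[i], eigenvalue (complexify A) z -> cmod z < 1.

(* [s] lists the complex eigenvalues of [A], each repeated according to its
   algebraic multiplicity. *)
Definition spectrum (R : realType) n (A : 'M[R]_n) (s : seq R[i]) : Prop :=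
  char_poly (complexify A) = \prod_(z <- s) ('X - z%:P).

(* The weight [A i j] belongs to the edge from [j] to [i]. Self-loops in [E],
   if any, carry no weight. *)
Definition weighted_adjacency (R : realType) n (E : rel 'I_n) (A : 'M[R]_n) : Prop :=
  (forall i, A i i = 0) /\
  (forall i j, i != j -> (E j i -> 0 < A i j) /\ (~~ E j i -> A i j = 0)).

(* Nodes 1, ..., N are [lift ord0 i] for [i : 'I_N]; the diagonal sum includes
   the weight of the edge coming from node 0. *)
Definition Hmx (R : realType) N (A : 'M[R]_N.+1) : 'M[R]_N :=
  \matrix_(i, j)
    if i == j then \sum_(k < N.+1) A (lift ord0 i) k
    else - A (lift ord0 i) (lift ord0 j).

(* a_l +- j b_l over l < N2, where each l < N1 contributes the single value a_l. *)
Definition paired_eigenvalues (R : realType) (N1 N2 : nat) (a b : 'I_N2 -> R)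
    : seq R[i] :=
  flatten [seq if (l < N1)%N then [:: (a l)%:C]
               else [:: a l +i* b l; a l -i* b l] | l : 'I_N2 <- enum 'I_N2].

(* [r] stands for the spectral radius |lambda_q| of S_0. *)
Definition Delta (R : realType) (r a b : R) : R :=
  (a ^+ 2 + b ^+ 2) / r ^+ 2 - b ^+ 2.

(* [Num.sqrt] is 0 on negative reals, so the two bounds are meaningful only when
   [Delta r a b >= 0]. *)
Definition lower_gain (R : realType) (r a b : R) : R :=
  (a - Num.sqrt (Delta r a b)) / (a ^+ 2 + b ^+ 2).

Definition upper_gain (R : realType) (r a b : R) : R :=
  (a + Num.sqrt (Delta r a b)) / (a ^+ 2 + b ^+ 2).

(* Maximum and minimum of a finite family of reals, taken in the extended reals
   so that they need no default real value; they are finite when [0 < n]. *)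
Definition max_family (R : realType) n (f : 'I_n -> R) : \bar R :=
  \big[maxe/-oo%E]_(l < n) (f l)%:E.

Definition min_family (R : realType) n (f : 'I_n -> R) : \bar R :=
  \big[mine/+oo%E]_(l < n) (f l)%:E.

(* Main.v *)
(**
  The eigenvalues of [(I - mu H) (x) S_0] are the products [(1 - mu h) lam] with
  [h] in the spectrum of [H] and [lam] in that of [S_0], so the matrix is Schur
  iff [|1 - mu h| r < 1] for every [h = a +- j b]. Multiplying
  [(1 - mu a)^2 + (mu b)^2 < 1 / r^2] by [a^2 + b^2] and completing the square
  turns this into [(mu (a^2 + b^2) - a)^2 < Delta], i.e. [mu] lies strictly
  between the two gains. The division is legitimate since reachability from
  node 0 makes [H] nonsingular, by a maximum principle.
*)
Require Import Defs.
From mathcomp Require Import all_boot all_order all_algebra.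
From mathcomp Require Import reals constructive_ereal.
From mathcomp Require Import spectral ring lra.

Set Implicit Arguments.
Unset Strict Implicit.
Unset Printing Implicit Defensive.

Import Order.TTheory GRing.Theory Num.Theory.
Local Open Scope ring_scope.

(** * Kronecker products and their eigenvalues *)

Lemma tensmx1 (R : pzRingType) m n : (1%:M *t 1%:M : 'M[R]_(m * n)) = 1%:M.
Proof.
apply/matrixP => i j; case: (mxtens_indexP i) => i0 i1.
case: (mxtens_indexP j) => j0 j1; rewrite tensmxE !mxE -natrM mulnb.
by rewrite (can_eq (@mxtens_indexK _ _)) xpair_eqE.
Qed.

Lemma tensmxBl (R : pzRingType) m n p q (A B : 'M[R]_(m, n)) (C : 'M[R]_(p, q)) :
  (A - B) *t C = A *t C - B *t C.
Proof. by apply/matrixP => i j; rewrite !mxE mulrBl. Qed.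

Lemma tensmxBr (R : pzRingType) m n p q (A : 'M[R]_(m, n)) (B C : 'M[R]_(p, q)) :
  A *t (B - C) = A *t B - A *t C.
Proof. by apply/matrixP => i j; rewrite !mxE mulrBr. Qed.

Lemma tensmxZl (R : pzRingType) m n p q c (A : 'M[R]_(m, n)) (C : 'M[R]_(p, q)) :
  (c *: A) *t C = c *: (A *t C).
Proof. by apply/matrixP => i j; rewrite !mxE mulrA. Qed.

Lemma tensmxZr (R : comPzRingType) m n p q c (A : 'M[R]_(m, n)) (C : 'M[R]_(p, q)) :
  A *t (c *: C) = c *: (A *t C).
Proof. by apply/matrixP => i j; rewrite !mxE mulrCA. Qed.

Lemma eigenvalue_unitmx (F : fieldType) n (A : 'M[F]_n) x :
  eigenvalue A x = (A - x%:M \notin unitmx).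
Proof. by rewrite /eigenvalue /eigenspace kermx_eq0 row_free_unit. Qed.

(** By contraposition: if [A - x%:M] is invertible, so is its Kronecker product with the identity.
    When a size is zero, no eigenvector exists. *)
Lemma eigenvalue_tensmx1 (F : fieldType) m n (A : 'M[F]_m) x :
  eigenvalue (A *t (1%:M : 'M_n)) x -> eigenvalue A x.
Proof.
case: m A => [|m] A; first by case/eigenvalueP => v _; rewrite thinmx0 eqxx.
case: n => [|n].
  case/eigenvalueP => v _ v0; have [i _] := elimT (rV0Pn v) v0.
  by case: (mxtens_indexP i) => _ [].
rewrite !eigenvalue_unitmx; apply: contra => uA.
suff -> : A *t 1%:M - x%:M = (A - x%:M) *t (1%:M : 'M_n.+1).
  by rewrite tensmx_unit ?unitmx1.
by rewrite tensmxBl -[x%:M in RHS]scalemx1 tensmxZl tensmx1 scalemx1.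
Qed.

Lemma eigenvalue_tens1mx (F : fieldType) m n (B : 'M[F]_n) x :
  eigenvalue ((1%:M : 'M_m) *t B) x -> eigenvalue B x.
Proof.
case: n B => [|n] B.
  case/eigenvalueP => v _ v0; have [i _] := elimT (rV0Pn v) v0.
  by case: (mxtens_indexP i) => _ [].
case: m => [|m]; first by case/eigenvalueP => v _; rewrite thinmx0 eqxx.
rewrite !eigenvalue_unitmx; apply: contra => uB.
suff -> : 1%:M *t B - x%:M = (1%:M : 'M_m.+1) *t (B - x%:M).
  by rewrite tensmx_unit ?unitmx1.
by rewrite tensmxBr -[x%:M in RHS]scalemx1 tensmxZr tensmx1 scalemx1.
Qed.

Lemma eigenvalue_tensmx (F : fieldType) m n (A : 'M[F]_m) (B : 'M[F]_n) x y :
  eigenvalue A x -> eigenvalue B y -> eigenvalue (A *t B) (x * y).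
Proof.
move=> /eigenvalueP[v vA v0] /eigenvalueP[w wB w0].
have [i vi] := elimT (rV0Pn v) v0; have [j wj] := elimT (rV0Pn w) w0.
apply/eigenvalueP; exists (v *t w : 'rV_(m * n)).
  have := tensmx_mul v w A B; rewrite vA wB tensmxZl tensmxZr scalerA.
  exact.
apply/eqP => vw0; suff /eqP: v 0 i * w 0 j = 0.
  by rewrite mulf_eq0 (negPf vi) (negPf wj).
by rewrite -tensmxE; have -> : v *t w = 0 by []; rewrite mxE.
Qed.

(* [A *t 1] commutes with [A *t B], so it has an eigenvector inside the given
   eigenspace of [A *t B]. *)
Lemma eigenvalue_tensmxP (C : numClosedFieldType) m n (A : 'M[C]_m) (B : 'M[C]_n) z :
  (0 < n)%N -> eigenvalue (A *t B) z ->
  exists x y, [/\ eigenvalue A x, eigenvalue B y & z = x * y].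
Proof.
move=> n_gt0 Hz; set f := A *t (1%:M : 'M_n); set g := (1%:M : 'M_m) *t B.
have fg : A *t B = f *m g by rewrite tensmx_mul mul1mx mulmx1.
have gf : A *t B = g *m f by rewrite tensmx_mul mul1mx mulmx1.
set V := eigenspace (A *t B) z.
have Vf : stablemx (row_base V) f.
  rewrite stablemx_row_base; apply: comm_mx_stable_eigenspace.
  by rewrite /comm_mx {1}fg -mulmxA -gf.
have rV : (0 < \rank V)%N by rewrite lt0n mxrank_eq0.
have [x /eigenvalueP[w wx w0]] := eigenvalue_closed (conjmx (row_base V) f) rV.
set v := w *m row_base V.
have v0 : v != 0 by rewrite mulmx_free_eq0 ?row_base_free.
have vf : v *m f = x *: v.
  apply/eigenspaceP; rewrite -sub_eigenspace_conjmx ?row_base_free //.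
  exact/eigenspaceP.
have vz : v *m (A *t B) = z *: v.
  by apply/eigenspaceP; apply: submx_trans (submxMl w _) _; rewrite eq_row_base.
have Ax : eigenvalue A x.
  by apply: (@eigenvalue_tensmx1 _ _ n); apply/eigenvalueP; exists v.
have xz : x *: (v *m g) = z *: v by rewrite -vz fg mulmxA vf -scalemxAl.
(* If [x = 0] then [z = 0], and any eigenvalue of [B] serves as [y]; one exists since [0 < n].
   Otherwise [v] is an eigenvector of [g] for [z / x]. *)
have [x0|x0] := eqVneq x 0.
  have [y By] := eigenvalue_closed B n_gt0; exists x, y; split=> //.
  by move/eqP: xz; rewrite x0 scale0r eq_sym scaler_eq0 (negPf v0) orbF mul0r => /eqP.
exists x, (z / x); split=> //; last by rewrite mulrC divfK.
apply: (@eigenvalue_tens1mx _ m); apply/eigenvalueP; exists v => //.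
by rewrite mulrC -scalerA -xz scalerK.
Qed.

Lemma eigenvalue_1subZ (F : fieldType) n (A : 'M[F]_n) c x :
  eigenvalue A x -> eigenvalue (1%:M - c *: A) (1 - c * x).
Proof.
move=> /eigenvalueP[v vA v0]; apply/eigenvalueP; exists v => //.
by rewrite mulmxBr mulmx1 -scalemxAr vA scalerA scalerBl scale1r.
Qed.

Lemma eigenvalue_1subZP (C : numClosedFieldType) n (A : 'M[C]_n) c z :
  eigenvalue (1%:M - c *: A) z -> exists2 x, eigenvalue A x & z = 1 - c * x.
Proof.
(* For [c = 0] the matrix is the identity, so [z = 1] and any eigenvalue of [A] will do; the nonzero
   [v] forces [0 < n], so one exists. *)
move=> /eigenvalueP[v vA v0]; have [c0|c0] := eqVneq c 0.
  have n_gt0 : (0 < n)%N by case: n v v0 {A vA} => // v; rewrite thinmx0 eqxx.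
  have [x Ax] := eigenvalue_closed A n_gt0; exists x => //.
  have /eqP : (1 - z) *: v = 0.
    by rewrite scalerBl scale1r -vA c0 scale0r subr0 mulmx1 subrr.
  by rewrite scaler_eq0 (negPf v0) orbF subr_eq0 c0 mul0r subr0 => /eqP.
exists ((1 - z) / c); last by rewrite mulrC divfK // subKr.
apply/eigenvalueP; exists v => //; rewrite mulrC -scalerA.
apply: (canRL (scalerK c0)); rewrite scalerBl scale1r -vA.
by rewrite mulmxBr mulmx1 -scalemxAr subKr.
Qed.

(** * Schur stability of the product and nonsingularity of [H] *)

Lemma cmod_ge0 (R : realType) (z : R[i]) : 0 <= cmod z.
Proof. by case: z => x y; exact: sqrtr_ge0. Qed.

Lemma mem_spectrum (R : realType) n (A : 'M[R]_n) s z :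
  spectrum A s -> eigenvalue (complexify A) z = (z \in s).
Proof. by move=> hs; rewrite eigenvalue_root_char hs root_prod_XsubC. Qed.

(** Moduli are multiplicative, so for each [h] the largest product comes from the dominant
    eigenvalue [lam] of [S]. *)
Lemma schur_stable_tens (R : realType) m n (H : 'M[R]_m) (S : 'M[R]_n) mu lam :
  eigenvalue (complexify S) lam ->
  (forall y, eigenvalue (complexify S) y -> cmod y <= cmod lam) ->
  schur_stable ((1%:M : 'M_m) *t S - mu *: (H *t S)) <->
  forall h, eigenvalue (complexify H) h -> cmod (1 - mu%:C%C * h) * cmod lam < 1.
Proof.
move=> Slam lam_max.
have -> : (1%:M : 'M_m) *t S - mu *: (H *t S) = (1%:M - mu *: H) *t S.
  by rewrite tensmxBl tensmxZl.
rewrite /schur_stable /complexify map_mxT map_mxB map_mx1 map_mxZ /=.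
have n_gt0 : (0 < n)%N.
  case: n S Slam {lam_max} => // S /eigenvalueP[v _].
  by rewrite thinmx0 eqxx.
split=> [st h Hh|st z].
  rewrite -ComplexField.Normc.normcM.
  exact (st _ (eigenvalue_tensmx (eigenvalue_1subZ mu%:C%C Hh) Slam)).
move=> /(eigenvalue_tensmxP n_gt0)[x [y [/eigenvalue_1subZP[h Hh ->] Sy ->]]].
rewrite ComplexField.Normc.normcM; apply: (le_lt_trans _ (st h Hh)).
by rewrite ler_wpM2l ?lam_max ?cmod_ge0.
Qed.

(* If [H v = 0], extended by [v_0 = 0], a node where [`|v|] is maximal passes
   maximality to its in-neighbours, hence back to node 0. *)
Lemma Hmx_unit (R : realType) N (E : rel 'I_N.+1) (A : 'M[R]_N.+1) :
  weighted_adjacency E A ->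
  (forall i : 'I_N, connect E ord0 (lift ord0 i)) -> Hmx A \in unitmx.
Proof.
(* Transposing turns the row vector given by [det0P] into a right null vector of [H]. *)
move=> [A0 AE] reach; rewrite -unitmx_tr unitmxE unitfE.
apply/det0P => -[v v0 vH].
pose w k := if unlift ord0 k is Some j then v 0 j else 0.
have w0 : w ord0 = 0 by rewrite /w unlift_none.
have wS j : w (lift ord0 j) = v 0 j by rewrite /w liftK.
have A_ge0 i j : 0 <= A i j.
  have [->|ij] := eqVneq i j; first by rewrite A0.
  by case: (AE i j ij); case: (E j i) => [/(_ isT)/ltW //|_ /(_ isT) ->].
(* Row [i] of [H v = 0]: the total incoming weight times the value at the node is the weighted sum
   of the values of [w], node 0 contributing 0. *)
have avg i : (\sum_k A (lift ord0 i) k) * v 0 i = \sum_k A (lift ord0 i) k * w k.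
  rewrite [RHS]big_ord_recl w0 mulr0 add0r; apply/eqP; rewrite -subr_eq0.
  move/matrixP/(_ 0 i)/eqP: vH; rewrite !mxE; congr (_ == 0).
  have -> : (\sum_k A (lift ord0 i) k) * v 0 i
      = \sum_j v 0 j * (if i == j then \sum_k A (lift ord0 i) k else 0).
    rewrite (bigD1 i) //= eqxx [X in _ + X]big1 ?addr0 1?mulrC // => j.
    by rewrite eq_sym => /negPf ->; rewrite mulr0.
  rewrite -sumrB; apply: eq_bigr => j _; rewrite !mxE wS.
  case: eqP => [->|_]; first by rewrite A0 mul0r subr0.
  by rewrite mulr0 sub0r mulrN mulrC.
case: (@arg_maxP _ _ _ ord0 xpredT (fun k => `|w k|)) => // m _ w_max0.
have w_max k : `|w k| <= `|w m| := w_max0 k isT.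
have m_gt0 : 0 < `|w m|.
  have [i vi] := elimT (rV0Pn v) v0; apply: lt_le_trans (w_max (lift ord0 i)).
  by rewrite wS normr_gt0.
have step x y : E x y -> `|w y| = `|w m| -> `|w x| = `|w m|.
  case: (unliftP ord0 y) => [i|] ->; last first.
    by rewrite w0 normr0 => _ m0; rewrite -m0 ltxx in m_gt0.
  have [<- //|yx] := eqVneq (lift ord0 i) x.
  move=> Exy wy; have [/(_ Exy) Ayx _] := AE _ _ yx.
  have ge0 k : true -> 0 <= A (lift ord0 i) k * (`|w m| - `|w k|).
    by move=> _; rewrite mulr_ge0 ?A_ge0 // subr_ge0 w_max.
  (* By [avg] and the triangle inequality this sum is at most 0, while its terms are nonnegative. So
     each term vanishes, and the positive weight of the edge from [x] makes the absolute value of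
     [w x] maximal. *)
  have /psumr_eq0P : \sum_k A (lift ord0 i) k * (`|w m| - `|w k|) = 0.
    apply/eqP; rewrite eq_le sumr_ge0 // andbT.
    under eq_bigr do rewrite mulrBr.
    rewrite sumrB subr_le0 -mulr_suml -wy wS -[X in X * _]ger0_norm ?sumr_ge0 //.
    rewrite -normrM avg (le_trans (ler_norm_sum _ _ _)) // ler_sum // => k _.
    by rewrite normrM ger0_norm.
  by move=> /(_ ge0 x isT)/eqP; rewrite mulf_eq0 gt_eqF //= subr_eq0 => /eqP <-.
have back p x : path E x p -> `|w (last x p)| = `|w m| -> `|w x| = `|w m|.
  elim: p x => //= y p IH x /andP[Exy yp] wp.
  exact: step Exy (IH _ yp wp).
have : `|w ord0| = `|w m|.
  case: (unliftP ord0 m) => [i mi|<- //].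
  have /connectP[p pE pi] := reach i.
  by apply: back pE _; rewrite -pi -mi.
by rewrite w0 normr0 => m0; rewrite -m0 ltxx in m_gt0.
Qed.

(** * The range of gains for a single eigenvalue of [H] *)

Lemma ltr_norm_sqrt (R : rcfType) (x y : R) :
  (`|x| < Num.sqrt y) = (x ^+ 2 < y).
Proof.
have [y0|y0] := ltP 0 y; first by rewrite -sqrtr_sqr ltr_sqrt.
(* Here [y <= 0], so [Num.sqrt y] is 0 and both sides are false. *)
rewrite ler0_sqrtr // normr_lt0; symmetry; apply/negbTE; rewrite -leNgt.
exact: le_trans y0 (sqr_ge0 _).
Qed.

(* With [P = a^2 + b^2], [P ((1 - mu a)^2 + (mu b)^2) = (P mu - a)^2 + b^2]. *)
Lemma cmod_lt1_gain (R : realType) (r a b mu : R) :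
  0 < r -> 0 < a ^+ 2 + b ^+ 2 ->
  (cmod (1 - mu%:C%C * (a +i* b)%C) * r < 1) = (lower_gain r a b < mu < upper_gain r a b).
Proof.
move=> r0 P0; rewrite /lower_gain /upper_gain ltr_pdivrMr // ltr_pdivlMr //.
have := ltr_norm_sqrt (mu * (a ^+ 2 + b ^+ 2) - a) (Delta r a b).
rewrite ltr_norml ltrBrDr ltrBlDr [- _ + a]addrC [_ + a]addrC => ->.
have -> : 1 - mu%:C%C * (a +i* b)%C = ((1 - mu * a) +i* (- (mu * b)))%C :> R[i].
  by simpc.
have ir0 : 0 < r^-1 by rewrite invr_gt0.
(* Writing [r^-1] as a square root allows comparing radicands; after multiplication by
   [a ^+ 2 + b ^+ 2], the two inequalities have equal differences of sides. *)
rewrite /= -ltr_pdivlMr // mul1r -(ger0_norm (ltW ir0)) -sqrtr_sqr.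
rewrite ltr_sqrt ?exprn_gt0 // -(ltr_pM2l P0) -[LHS]subr_gt0 -[RHS]subr_gt0.
by congr (0 < _); rewrite /Delta; field; rewrite gt_eqF.
Qed.

Lemma Delta_gt0 (R : realType) (r a b : R) : 0 < r ->
  (0 < Delta r a b) = (b ^+ 2 * r ^+ 2 < a ^+ 2 + b ^+ 2).
Proof. by move=> r0; rewrite /Delta subr_gt0 ltr_pdivlMr // exprn_gt0. Qed.

(** The gap between the gains is a positive multiple of [Num.sqrt (Delta r a b)]. This recovers the
    condition on [Delta] from a nonempty interval of gains. *)
Lemma gain_lt (R : realType) (r a b : R) : 0 < a ^+ 2 + b ^+ 2 ->
  (lower_gain r a b < upper_gain r a b) = (0 < Delta r a b).
Proof.
move=> P0; rewrite /lower_gain /upper_gain ltr_pM2r ?invr_gt0 // ltrD2l.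
by rewrite -sqrtr_gt0; apply/idP/idP; lra.
Qed.

(** * Extrema of finite families and the listed eigenvalues *)

Lemma ereal_lt_between (R : realType) (x y : \bar R) :
  (x < y)%E -> exists mu : R, (x < mu%:E)%E /\ (mu%:E < y)%E.
Proof.
(* Infinite endpoints arise from empty families of gains. *)
case: x y => [x| |] [y| |] //.
- rewrite lte_fin => xy; exists ((x + y) / 2).
  by rewrite !lte_fin; split; lra.
- by move=> _; exists (x + 1); rewrite lte_fin ltrDl ltr01 ltry.
- by move=> _; exists (y - 1); rewrite lte_fin ltrBlDr ltrDl ltr01 ltNyr.
- by move=> _; exists 0; rewrite ltry ltNyr.
Qed.

Lemma max_family_lt (R : realType) n (f : 'I_n -> R) (x : R) :
  (max_family f < x%:E)%E <-> forall l, f l < x.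
Proof.
rewrite /max_family; split=> [/bigmax_ltP[_ fx] l|fx].
  by rewrite -lte_fin fx.
by apply/bigmax_ltP; split=> [|l _]; rewrite ?ltNyr ?lte_fin.
Qed.

Lemma lt_min_family (R : realType) n (f : 'I_n -> R) (x : R) :
  (x%:E < min_family f)%E <-> forall l, x < f l.
Proof.
rewrite /min_family; split=> [/bigmin_gtP[_ fx] l|fx].
  by rewrite -lte_fin fx.
by apply/bigmin_gtP; split=> [|l _]; rewrite ?ltry ?lte_fin.
Qed.

(** Since [b l = 0] for [l < N1], a single real eigenvalue also has the form [a l +i* b l], so both
    kinds of index can be treated alike. *)
Lemma mem_paired_eigenvalues (R : realType) N1 N2 (a b : 'I_N2 -> R) :
  (forall l : 'I_N2, (l < N1)%N -> b l = 0) ->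
  (forall l, (a l +i* b l)%C \in paired_eigenvalues N1 a b) /\
  (forall z, z \in paired_eigenvalues N1 a b ->
     exists l, z = (a l +i* b l)%C \/ z = (a l -i* b l)%C).
Proof.
move=> hb0; split=> [l|z].
  apply/flatten_mapP; exists l; rewrite ?mem_enum //.
  by case: ifP => [/hb0 ->|_]; rewrite inE eqxx.
case/flatten_mapP => l _ zl; exists l; move: zl.
case: ifP => [/hb0 ->|_]; rewrite !inE; first by move/eqP; left.
by case/orP => /eqP; [left|right].
Qed.

Theorem lemma3p1 (R : realType) (N : nat)
  (E : rel 'I_N.+1) (A : 'M[R]_N.+1)
  (hA : weighted_adjacency E A)
  (hreach : forall i : 'I_N, connect E ord0 (lift ord0 i))
  (q : nat) (S0 : 'M[R]_q.+1) (lam : 'I_q.+1 -> R[i])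
  (hlam : spectrum S0 (codom lam))
  (hmono : forall i j : 'I_q.+1, (i <= j)%N -> cmod (lam i) <= cmod (lam j))
  (hlamq : lam ord_max != 0)
  (N1 N2 : nat) (a b : 'I_N2 -> R)
  (hN1 : (N1 <= N2)%N) (hN : (N1 + 2 * (N2 - N1))%N = N)
  (hb0 : forall l : 'I_N2, (l < N1)%N -> b l = 0)
  (hb1 : forall l : 'I_N2, (N1 <= l)%N -> b l != 0)
  (hH : spectrum (Hmx A) (paired_eigenvalues N1 a b)) :
  let r : R := cmod (lam ord_max) in
  let M (mu : R) : 'M[R]_(N * q.+1) := (1%:M : 'M[R]_N) *t S0 - mu *: (Hmx A *t S0) in
  let lo : \bar R := max_family (fun l => lower_gain r (a l) (b l)) in
  let hi : \bar R := min_family (fun l => upper_gain r (a l) (b l)) in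
  let C1 : Prop := forall l, a l ^+ 2 + b l ^+ 2 > b l ^+ 2 * r ^+ 2 in
  let C2 : Prop := (lo < hi)%E in
  ((exists mu : R, schur_stable (M mu)) <-> (C1 /\ C2)) /\
  (C1 /\ C2 -> forall mu : R, (lo < mu%:E)%E -> (mu%:E < hi)%E -> schur_stable (M mu)).
Proof.
move=> r M lo hi C1 C2.
have r0 : 0 < r.
  rewrite lt_neqAle cmod_ge0 andbT eq_sym.
  by apply: contra hlamq => /eqP/ComplexField.Normc.eq0_normc ->.
have [ab_mem mem_ab] := mem_paired_eigenvalues a hb0.
(* If this sum were 0, then 0 would be an eigenvalue of the invertible matrix [Hmx A]. *)
have P0 l : 0 < a l ^+ 2 + b l ^+ 2.
  have : eigenvalue (complexify (Hmx A)) (a l +i* b l)%C by rewrite (mem_spectrum _ hH).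
  rewrite lt_neqAle addr_ge0 ?sqr_ge0 // andbT => ev.
  apply: contraL ev => /eqP/esym/eqP; rewrite paddr_eq0 ?sqr_ge0 // !sqrf_eq0.
  case/andP => /eqP -> /eqP ->; rewrite eigenvalue_unitmx negbK raddf0 subr0.
  by rewrite map_unitmx (Hmx_unit hA hreach).
(* Both claims reduce to this equivalence at a fixed [mu]. *)
have stable mu : schur_stable (M mu) <-> (lo < mu%:E)%E /\ (mu%:E < hi)%E.
  have lamP : eigenvalue (complexify S0) (lam ord_max).
    by rewrite (mem_spectrum _ hlam) codom_f.
  have lam_max y : eigenvalue (complexify S0) y -> cmod y <= cmod (lam ord_max).
    by rewrite (mem_spectrum _ hlam) => /codomP[i ->]; apply/hmono/leq_ord.
  apply: iff_trans (schur_stable_tens (Hmx A) mu lamP lam_max) _.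
  split=> [st|[/max_family_lt lo_mu /lt_min_family mu_hi] h].
    have gain l : lower_gain r (a l) (b l) < mu < upper_gain r (a l) (b l).
      by rewrite -cmod_lt1_gain // st // (mem_spectrum _ hH).
    by split; [apply/max_family_lt|apply/lt_min_family] => l; case/andP: (gain l).
  rewrite (mem_spectrum _ hH) => /mem_ab[l [|] ->].
    by rewrite cmod_lt1_gain // lo_mu mu_hi.
  (* The conjugate eigenvalue gives the same gains, since [b l] enters them only through its
     square. *)
  rewrite cmod_lt1_gain ?sqrrN //.
  by rewrite /lower_gain /upper_gain /Delta sqrrN; apply/andP; split; [exact: lo_mu|exact: mu_hi].
split; last by move=> _ mu lo_mu mu_hi; apply/stable.
split=> [[mu /stable[lo_mu mu_hi]]|[_ /ereal_lt_between[mu lo_mu_hi]]]; last first.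
  by exists mu; apply/stable.
split; last exact: lt_trans lo_mu mu_hi.
(* For each [l], [mu] lies strictly between the two gains, so [Delta] is positive, which is the
   condition [C1]. *)
move: lo_mu mu_hi => /max_family_lt lo_mu /lt_min_family mu_hi l.
by rewrite -Delta_gt0 // -gain_lt // (lt_trans (lo_mu l) (mu_hi l)).
Qed.
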